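(* Consider the stochastic linear system, the stochastic optimal control problem (SOC) and the risk-allocation problem (RA) described in the context, and assume that the probability density $\psi_{\boldsymbol W}$ of the concatenated disturbance $\boldsymbol W$ is log-concave. Then for any $\Delta\in[0,1)$ and any $\epsilon>0$ the following hold. 1) Every feasible solution of (RA) is feasible for (SOC); that is, if $(\overline U,\overline t)\in\mathbb{R}^{mN}\times\mathbb{R}^{L_X}$ satisfies the constraints (RA-b)--(RA-f), then $\overline U\in\mathcal U^N$ and $\mathbb{P}\{P\boldsymbol X_{\overline U}\le \overline q\}\ge 1-\Delta$. 2) The cost (RA-a) and the constraints (RA-b), (RA-c), (RA-d) are convex in the decision variables $(\overline U,\overline t)$. However, (RA-f) is a reverse convex constraint, i.e. it is of the form $f(\overline t)\ge 0$ with $f$ a convex function.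
   Context: **System.** For $k=0,\dots,N-1$ (with $N\in\mathbb{N}$), $\boldsymbol x(k+1)=A(k)\boldsymbol x(k)+B(k)\overline u(k)+\boldsymbol w(k)$, with state $\boldsymbol x(k)\in\mathbb{R}^n$, deterministic input $\overline u(k)\in\mathcal U\subset\mathbb{R}^m$ where $\mathcal U$ is a (convex) polytope, random disturbance $\boldsymbol w(k)\in\mathbb{R}^n$, and a fixed deterministic initial state $\overline x(0)\in\mathbb{R}^n$. The concatenated disturbance $\boldsymbol W=[\boldsymbol w(0)^\top\ \cdots\ \boldsymbol w(N-1)^\top]^\top\in\mathbb{R}^{nN}$ has a probability density $\psi_{\boldsymbol W}$, mean $\overline\mu_{\boldsymbol W}$ and covariance matrix $C_{\boldsymbol W}$. A nonnegative function is log-concave if its logarithm is concave, with the convention $\log 0=-\infty$. Let $\overline U=[\overline u(0)^\top\ \cdots\ \overline u(N-1)^\top]^\top\in\mathbb{R}^{mN}$ and $\boldsymbol X_{\overline U}=[\boldsymbol x(1)^\top\ \cdots\ \boldsymbol x(N)^\top]^\top\in\mathbb{R}^{nN}$. Then $\boldsymbol X_{\overline U}=\bar A\,\overline x(0)+H\overline U+G\boldsymbol W$, where the matrices $\bar A\in\mathbb{R}^{nN\times n}$, $H\in\mathbb{R}^{nN\times mN}$, $G\in\mathbb{R}^{nN\times nN}$ are determined by the dynamics. The mean and covariance of $\boldsymbol X_{\overline U}$ are $$\overline\mu_{\boldsymbol X,\overline U}=\bar A\,\overline x(0)+H\overline U+G\overline\mu_{\boldsymbol W},\qquad C_{\boldsymbol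 X,\overline U}=GC_{\boldsymbol W}G^\top .$$ **Data.** $Q\in\mathbb{R}^{nN\times nN}$ and $R\in\mathbb{R}^{mN\times mN}$ are positive semidefinite. The safe set is the polytope $\mathscr S=\{\overline X\in\mathbb{R}^{nN}:P\overline X\le\overline q\}$, where $P\in\mathbb{R}^{L_X\times nN}$ has rows $\overline p_1^\top,\dots,\overline p_{L_X}^\top$, $\overline q=[q_1\ \cdots\ q_{L_X}]^\top\in\mathbb{R}^{L_X}$, $L_X\in\mathbb{N}$, $L_X\ge1$. $\overline X_{\mathrm d}\in\mathscr S$ is a desired trajectory. $\Delta\in[0,1)$ is the probabilistic constraint violation threshold. **Problem (SOC).** Minimize over $\overline U\in\mathbb{R}^{mN}$ the cost $$\mathbb{E}\big[(\boldsymbol X_{\overline U}-\overline X_{\mathrm d})^\top Q(\boldsymbol X_{\overline U}-\overline X_{\mathrm d})+\overline U^\top R\overline U\big]$$ subject to $\overline U\in\mathcal U^N$ and $\mathbb{P}\{\boldsymbol X_{\overline U}\in\mathscr S\}\ge 1-\Delta$. **Problem (RA).** Let $\Phi_{\overline p_i^\top G\boldsymbol W}(s)=\mathbb{P}\{\overline p_i^\top G\boldsymbol W\le s\}$ for $s\in\mathbb{R}$, let $\Phi^{-1}_{\overline p_i^\top G\boldsymbol W}(\epsilon)=\inf\{s\in\mathbb{R}:\Phi_{\overline p_i^\top G\boldsymbol W}(s)\ge\epsilon\}$ denote the quantile function (with $\inf\emptyset=+\infty$, in which case the constraint (RA-c) below is infeasible), and let $d_i=q_i-\overline p_i^\top\bar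 A\,\overline x(0)$. For a given $\epsilon>0$, with decision variables $\overline U\in\mathbb{R}^{mN}$ and $\overline t=[t_1,\dots,t_{L_X}]\in\mathbb{R}^{L_X}$: - (RA-a) minimize $(\overline\mu_{\boldsymbol X,\overline U}-\overline X_{\mathrm d})^\top Q(\overline\mu_{\boldsymbol X,\overline U}-\overline X_{\mathrm d})+\overline U^\top R\overline U+\mathrm{tr}(QC_{\boldsymbol X,\overline U})$, subject to - (RA-b) $\overline U\in\mathcal U^N$; - (RA-c) $\overline p_i^\top H\overline U+\Phi^{-1}_{\overline p_i^\top G\boldsymbol W}(\epsilon)\le d_i$ for all $i\in\{1,\dots,L_X\}$; - (RA-d) $\log\big(\Phi_{\overline p_i^\top G\boldsymbol W}(d_i-\overline p_i^\top H\overline U)\big)\ge t_i$ for all $i\in\{1,\dots,L_X\}$; - (RA-e) $t_i\in[\log(1-\Delta),0]$ for all $i\in\{1,\dots,L_X\}$; - (RA-f) $\log\big(\sum_{i=1}^{L_X}\exp(t_i)\big)\ge\log(L_X-\Delta)$. *)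

(* Defs.v *)
From HB Require Import structures.
From mathcomp Require Import all_boot all_order all_algebra.
From mathcomp Require Import all_classical all_reals all_analysis.

Set Implicit Arguments.
Unset Strict Implicit.
Unset Printing Implicit Defensive.

Import Order.TTheory GRing.Theory Num.Theory.
Import numFieldNormedType.Exports.

Local Open Scope classical_set_scope.
Local Open Scope ring_scope.

(* Dimension of N stacked vectors of length c, in the form used by the block
   constructions \mxcol, submxcol and \mxblock. *)
Notation stacked N c := (\sum_(k < N) c)%N (only parsing).

(* d-dimensional Lebesgue measure on d.-tuples (whose sigma-algebra is the one
   generated by the coordinates, i.e. the Borel sets of R^d): the d-fold
   product measure, starting from the unit mass on the 0-tuple. It is built by
   hand because the sigma-finiteness of the library's product measure is not
   found by canonical structure inference. *)
Section lebesgue_tuple.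
Context {R : realType}.
Local Open Scope ereal_scope.
Local Notation rT := (measurableTypeR R).

Definition cons_pair n (z : rT * n.-tuple rT) : n.+1.-tuple rT :=
  [tuple of z.1 :: z.2].

Lemma measurable_cons_pair n : measurable_fun [set: rT * n.-tuple rT] (@cons_pair n).
Proof. exact: measurable_cons. Qed.

Section step.
Variables (n : nat) (mu : {sigma_finite_measure set (n.-tuple rT) -> \bar R}).

Definition lebesgue_cons : set (n.+1.-tuple rT) -> \bar R :=
  pushforward (lebesgue_measure \x mu) (@cons_pair n).

Let pf : {measure set (n.+1.-tuple rT) -> \bar R} :=
  measure_function_pushforward__canonical__measure_function_Measure
    (lebesgue_measure \x mu) (@measurable_cons_pair n).

Let lebesgue_cons0 : lebesgue_cons set0 = 0.
Proof. exact: (@measure0 _ _ _ pf). Qed.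

Let lebesgue_cons_ge0 A : 0 <= lebesgue_cons A.
Proof. exact: (@measure_ge0 _ _ _ pf). Qed.

Let lebesgue_cons_sigma_additive : semi_sigma_additive lebesgue_cons.
Proof. exact: (@measure_semi_sigma_additive _ _ _ pf). Qed.

HB.instance Definition _ := isMeasure.Build _ _ _ lebesgue_cons
  lebesgue_cons0 lebesgue_cons_ge0 lebesgue_cons_sigma_additive.

Let lebesgue_cons_sigma_finite : sigma_finite setT lebesgue_cons.
Proof.
have /sigma_finiteP[F [TF ndF Foo]] := sigma_finiteT (@lebesgue_measure R).
have /sigma_finiteP[G [TG ndG Goo]] := sigma_finiteT mu.
pose uncons (t : n.+1.-tuple rT) : rT * n.-tuple rT :=
  (thead t, [tuple of behead t]).
have consK (t : n.+1.-tuple rT) : cons_pair (uncons t) = t.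
  by apply/val_inj; rewrite /= [in RHS](tuple_eta t).
have unconsK (z : rT * n.-tuple rT) : uncons (cons_pair z) = z.
  by case: z => a v; rewrite /uncons /cons_pair /=; congr pair; apply/val_inj.
have muncons : measurable_fun [set: n.+1.-tuple rT] uncons.
  apply/measurable_fun_pairP; split.
    rewrite (_ : _ \o _ = (@tnth _ rT ^~ ord0)); last by [].
    exact: measurable_tnth.
  exact: measurable_behead.
exists (fun k => uncons @^-1` (F k `*` G k)).
  apply/esym; rewrite -subTset => t _.
  have [i _ Fi] : (\bigcup_i F i) (uncons t).1 by rewrite -TF.
  have [j _ Gj] : (\bigcup_i G i) (uncons t).2 by rewrite -TG.
  exists (maxn i j) => //; split.
  - by move: Fi; exact/subsetPset/ndF/leq_maxl.
  - by move: Gj; exact/subsetPset/ndG/leq_maxr.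
move=> k; have [mF Flt] := Foo k; have [mG Glt] := Goo k; split.
  by rewrite -[X in measurable X]setTI; apply: muncons => //; exact: measurableX.
have consFG : @cons_pair n @^-1` (uncons @^-1` (F k `*` G k)) = F k `*` G k.
  by rewrite -comp_preimage (_ : uncons \o _ = id) //; exact/funext.
rewrite /lebesgue_cons /pushforward consFG.
by rewrite product_measure1E// lte_mul_pinfty// ge0_fin_numE.
Qed.

HB.instance Definition _ := Measure_isSigmaFinite.Build _ _ _ lebesgue_cons
  lebesgue_cons_sigma_finite.

End step.

Fixpoint lebesgue_tuple n : {sigma_finite_measure set (n.-tuple rT) -> \bar R} :=
  match n with
  | 0 => [the sigma_finite_measure _ _ of \d_([tuple] : 0.-tuple rT)]
  | k.+1 => [the sigma_finite_measure _ _ of lebesgue_cons (lebesgue_tuple k)]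
  end.

End lebesgue_tuple.

Section convexity.
Context {R : realType} {E : lmodType R}.

(* Convexity of an extended-real-valued function is convexity of its epigraph,
   so that no convention on (+oo) + (-oo) is involved. *)
Definition econvex_function (f : E -> \bar R) : Prop :=
  convex_set [set z : convex_lmodType (E * R^o)%type | (f z.1 <= (z.2 : R)%:E)%E].

(* lne maps 0 to -oo. *)
Definition log_concave (psi : E -> R) : Prop :=
  (forall x, 0 <= psi x) /\ econvex_function (fun x => (- lne (psi x)%:E)%E).

Definition convex_constraint (C : set E) (g : E -> \bar R) : Prop :=
  econvex_function g /\ forall x, C x <-> (g x <= 0)%E.

Definition reverse_convex_constraint (C : set E) (f : E -> R) : Prop :=
  convex_function setT f /\ forall x, C x <-> 0 <= f x.

End convexity.

Definition polyhedron {R : realType} {r d} (F : 'M[R]_(r, d)) (g : 'cV[R]_r) :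
  set 'cV[R]_d := [set x | forall i, (F *m x) i 0 <= g i 0].

Definition polytope {R : realType} {d} (S : set 'cV[R]_d) : Prop :=
  exists r (F : 'M[R]_(r, d)) (g : 'cV[R]_r), S = polyhedron F g.

Definition quad {R : realType} {d} (M : 'M[R]_d) (v : 'cV[R]_d) : R :=
  (v^T *m M *m v) 0 0.

Definition psd {R : realType} {d} (M : 'M[R]_d) : Prop :=
  M^T = M /\ forall v, 0 <= quad M v.

Section random_vectors.
Context {disp : measure_display} {T : measurableType disp} {R : realType}.
Variable P : probability T R.

Definition has_density {d} (V : T -> 'cV[R]_d) (psi : 'cV[R]_d -> R) : Prop :=
  [/\ forall x, 0 <= psi x,
      measurable_fun setT
        (fun t : d.-tuple (measurableTypeR R) => psi (\col_i tnth t i)) &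
      forall S : set (d.-tuple (measurableTypeR R)), measurable S ->
        P [set w | S [tuple V w i 0 | i < d]]
        = (\int[lebesgue_tuple d]_(t in S) (psi (\col_i tnth t i))%:E)%E].

Definition coord {d} (V : T -> 'cV[R]_d) (i : 'I_d) : T -> R :=
  fun w => V w i 0.

(* In particular the components are measurable, and the mean vector and the
   covariance matrix exist. *)
Definition square_integrable {d} (V : T -> 'cV[R]_d) : Prop :=
  forall i, coord V i \in Lfun P 2%:E.

Definition mean_vec {d} (V : T -> 'cV[R]_d) : 'cV[R]_d :=
  \col_i fine ('E_P[coord V i])%E.

Definition cov_mx {d} (V : T -> 'cV[R]_d) : 'M[R]_d :=
  \matrix_(i, j) fine (covariance P (coord V i) (coord V j)).

End random_vectors.

Section dynamics.
Context {R : realType} {n m N : nat}.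
Variables (A : 'I_N -> 'M[R]_n) (B : 'I_N -> 'M[R]_(n, m)) (x0 : 'cV[R]_n).

(* Extension by 0 of a family indexed by {0, ..., N-1} to all of nat; only the
   indices k < N matter below. *)
Definition ext {V : zmodType} (f : 'I_N -> V) (k : nat) : V := oapp f 0 (insub k).

Fixpoint state (u : 'I_N -> 'cV[R]_m) (w : 'I_N -> 'cV[R]_n) (k : nat) : 'cV[R]_n :=
  if k is k'.+1
  then ext A k' *m state u w k' + ext B k' *m ext u k' + ext w k'
  else x0.

(* A(k-1) ... A(j) for j < k, and the identity for j >= k. *)
Fixpoint transition (j k : nat) : 'M[R]_n :=
  if k is k'.+1
  then if (j <= k')%N then ext A k' *m transition j k' else 1%:M
  else 1%:M.

Definition Abar : 'M[R]_(stacked N n, n) := \mxcol_(k < N) transition 0 k.+1.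

Definition Hmx : 'M[R]_(stacked N n, stacked N m) :=
  \mxblock_(k < N, j < N)
    (if (j <= k)%N then transition j.+1 k.+1 *m B j else 0).

Definition Gmx : 'M[R]_(stacked N n) :=
  \mxblock_(k < N, j < N) (if (j <= k)%N then transition j.+1 k.+1 else 0).

(* The concatenation of x(1), ..., x(N), where U is the concatenation of
   u(0), ..., u(N-1). *)
Definition trajectory (U : 'cV[R]_(stacked N m)) (w : 'I_N -> 'cV[R]_n) :
  'cV[R]_(stacked N n) := \mxcol_(k < N) state (submxcol U) w k.+1.

Definition input_power (Uset : set 'cV[R]_m) : set 'cV[R]_(stacked N m) :=
  [set U | forall k : 'I_N, Uset (submxcol U k)].

End dynamics.
Arguments input_power {R m N}.

Section problems.
Context {disp : measure_display} {T : measurableType disp} {R : realType}.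
Variable P : probability T R.
Context {n m N L : nat}.
Variables (A : 'I_N -> 'M[R]_n) (B : 'I_N -> 'M[R]_(n, m)) (x0 : 'cV[R]_n).
Variable w : 'I_N -> T -> 'cV[R]_n.
Variable Uset : set 'cV[R]_m.
Variables (Q : 'M[R]_(stacked N n)) (Rm : 'M[R]_(stacked N m)).
Variable Xd : 'cV[R]_(stacked N n).
Variables (Pm : 'M[R]_(L, stacked N n)) (q : 'cV[R]_L).
Variables (Delta eps : R).
Implicit Types (U : 'cV[R]_(stacked N m)) (t : 'cV[R]_L) (i : 'I_L).

Definition W (omega : T) : 'cV[R]_(stacked N n) := \mxcol_(k < N) w k omega.

Definition Xrv U (omega : T) : 'cV[R]_(stacked N n) :=
  trajectory A B x0 U (w ^~ omega).

Definition SOC_feasible U : Prop :=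
  input_power Uset U /\
  ((1 - Delta)%:E <= P [set omega | polyhedron Pm q (Xrv U omega)])%E.

Definition Phi i (s : R) : \bar R :=
  P [set omega | (row i Pm *m Gmx A *m W omega) 0 0 <= s].

(* ereal_inf set0 = +oo. *)
Definition Phi_inv i (e : R) : \bar R :=
  ereal_inf [set s%:E | s in [set s : R | (e%:E <= Phi i s)%E]].

Definition margin i : R := q i 0 - (row i Pm *m Abar A *m x0) 0 0.

Definition pHU i U : R := (row i Pm *m Hmx A B *m U) 0 0.

Definition RA_cost U t : R :=
  quad Q (mean_vec P (Xrv U) - Xd) + quad Rm U
  + \tr (Q *m cov_mx P (Xrv U)).

Definition RA_b U t : Prop := input_power Uset U.

Definition RA_c i U t : Prop :=
  ((pHU i U)%:E + Phi_inv i eps <= (margin i)%:E)%E.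

Definition RA_d i U t : Prop :=
  ((t i 0)%:E <= lne (Phi i (margin i - pHU i U)))%E.

Definition RA_e i t : Prop := ln (1 - Delta) <= t i 0 <= 0.

Definition RA_f t : Prop := ln (L%:R - Delta) <= ln (\sum_(i < L) expR (t i 0)).

Definition RA_feasible U t : Prop :=
  [/\ RA_b U t, forall i, RA_c i U t, forall i, RA_d i U t, forall i, RA_e i t
    & RA_f t].

End problems.

(* Main.v *)
Require Import Defs.
From HB Require Import structures.
From mathcomp Require Import all_boot all_order all_algebra.
From mathcomp Require Import all_classical all_reals all_analysis.
From mathcomp Require Import measurable_realfun ring lra.

Set Implicit Arguments.
Unset Strict Implicit.
Unset Printing Implicit Defensive.

Import Order.TTheory GRing.Theory Num.Theory.
Import numFieldNormedType.Exports.

Local Open Scope classical_set_scope.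
Local Open Scope convex_scope.
Local Open Scope ring_scope.

(** The trajectory is an affine function of the input and of the disturbance
    ([trajectoryE]). Hence each inequality defining the safe set constrains a
    linear functional of [W] from above, by an affine function of the input, and
    its probability is the value of the distribution function [Phi i] there.

    Part 1 is Boole's inequality ([bonferroni]): the safe set is violated with
    probability at most the sum of the risks [1 - Phi i], each of which is at most
    [1 - exp t_i] by (d), and (f) bounds the sum of the latter by [Delta].

    In part 2, the cost is a sum of positive semidefinite quadratic forms in
    affine functions of the input plus a constant, because translating a random
    vector does not change its covariance ([RA_costE], [quad_convex]). Constraint
    (c) is affine, and the function in (f) is a log-sum-exp
    ([log_sum_exp_convex]). The substance is (d): the distribution function of a
    linear functional of a vector with log-concave density is log-concave
    ([cdf_linear_log_dominates]). This is Prekopa's theorem. It follows from the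
    Prekopa-Leindler inequality ([prekopa_leindler]) for the density cut off
    outside half-spaces. That inequality goes by induction on the dimension, a
    product measure being integrated one coordinate at a time. In dimension 1
    ([prekopa_leindler1]) the functions are scaled so that all their level
    sets of levels below 1 are nonempty ([normalization]), the measures of these
    sets are compared by the Brunn-Minkowski inequality on the line
    ([brunn_minkowski1]), and integrating over the levels gives back the
    integrals ([layer_cake1]). *)

(** * The one-dimensional Brunn-Minkowski inequality *)

Section brunn_minkowski.
Context {R : realType}.
Local Notation mu := (@lebesgue_measure R).
Local Open Scope ereal_scope.

Lemma lebesgue_measure_homothety (c a : R) (A : set R) : (0 < c)%R ->
  measurable A -> mu [set z | A ((z - a) / c)%R] = c%:E * mu A.
Proof.
move=> c0 mA.
pose f (z : measurableTypeR R) : measurableTypeR R := ((z - a) / c)%R.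
have mf : measurable_fun setT f.
  by apply: measurable_funM => //; exact: measurable_funB.
have c'0 : (0 <= c^-1)%R by rewrite invr_ge0 ltW.
pose nu := mscale (NngNum c'0) (pushforward mu f).
have E : mu A = nu mf A.
  apply: lebesgue_measure_unique => // _ [[x y]] _ <-.
  have pre : f @^-1` `]x, y] = `](c * x + a)%R, (c * y + a)%R]%classic.
    apply/seteqP; split => z /=;
      by rewrite !in_itv/= /f ltr_pdivlMr// ler_pdivrMr//; lra.
  transitivity (c^-1%:E * mu (f @^-1` `]x, y])); last by [].
  rewrite pre.
  rewrite !lebesgue_measure_itv/= !lte_fin ltrD2r ltr_pM2l//.
  case: ifPn => _; last by rewrite mule0.
  by rewrite -!EFinB -EFinM; congr EFin; field; rewrite gt_eqF.
rewrite E; transitivity (c%:E * (c^-1%:E * mu (f @^-1` A))); last by [].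
rewrite muleA -EFinM divff ?mul1e//.
by rewrite gt_eqF.
Qed.

(** With [M] the maximum of [A] and [m] the minimum of [B], the set [C] contains
    the two copies [l A + k m] and [l M + k B]. The first one lies to the left
    of the point [l M + k m] and the second one to its right, so they overlap
    in at most that point and their measures add up. *)
Lemma brunn_minkowski1_compact (l k : R) (A B C : set R) :
  (0 < l)%R -> (0 < k)%R ->
  compact A -> compact B -> measurable C -> A !=set0 -> B !=set0 ->
  (forall x y, A x -> B y -> C (l * x + k * y)%R) ->
  l%:E * mu A + k%:E * mu B <= mu C.
Proof.
move=> l0 k0 cA cB mC A0 B0 ABC.
have [M AM Mmax] : exists2 M, M \in A & forall t, t \in A -> (t <= M)%R.
  by apply: (@compact_EVT_max _ _ id _ A0 cA);
    apply: continuous_subspaceT => x; exact: cvg_id.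
have [m Bm mmin] : exists2 m, m \in B & forall t, t \in B -> (m <= t)%R.
  by apply: (@compact_EVT_min _ _ id _ B0 cB);
    apply: continuous_subspaceT => x; exact: cvg_id.
have mA := compact_measurable cA; have mB := compact_measurable cB.
pose U := [set z | A ((z - k * m) / l)%R].
pose V := [set z | B ((z - l * M) / k)%R].
have mpre (a c : R) D : measurable D -> measurable [set z : R | D ((z - a) / c)%R].
  move=> mD; rewrite -[X in measurable X]setTI.
  apply: (_ : measurable_fun setT (fun z : R => ((z - a) / c)%R)) => //.
  by apply: measurable_funM => //; exact: measurable_funB.
have mU : measurable U by exact: mpre.
have mV : measurable V by exact: mpre.
rewrite -(lebesgue_measure_homothety (k * m)%R l0 mA).
rewrite -(lebesgue_measure_homothety (l * M)%R k0 mB).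
pose p := (l * M + k * m)%R.
have UVp : U `&` V `<=` [set p].
  move=> z [/= Uz Vz].
  have := Mmax _ (mem_set Uz); have := mmin _ (mem_set Vz).
  by rewrite ler_pdivrMr// ler_pdivlMr//= /p => *; lra.
have -> : mu [set z | A ((z - k * m) / l)%R] = mu (U `\` [set p]).
  rewrite -/U (measureDI mu mU (measurable_set1 p)).
  rewrite [X in _ + X](_ : _ = 0) ?adde0//.
  apply: (@subset_measure0 _ _ _ mu _ [set p]) => //.
    exact: measurableI.
  exact: lebesgue_measure_set1.
rewrite -measureU//; last 2 first.
- exact: measurableD.
- by apply/seteqP; split => // z [[Uz zp] Vz]; exact/zp/UVp.
apply: le_measure; rewrite ?inE//.
  by apply: measurableU => //; exact: measurableD.
move=> z [[Uz _]|Vz].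
  have := ABC _ _ Uz (set_mem Bm); congr C.
  by rewrite mulrCA divff ?mulr1 ?gt_eqF// subrK.
have := ABC _ _ (set_mem AM) Vz; congr C.
by rewrite [X in (_ + X)%R]mulrCA divff ?mulr1 ?gt_eqF// addrC subrK.
Qed.

(** Inner regularity approximates [A] and [B] by compact subsets, to which a point
    of [A], resp. [B], is added because the compact case needs nonempty sets:
    without this requirement the inequality fails, as [C] may be empty when
    only one of [A] and [B] is. *)
Lemma brunn_minkowski1 (l k : R) (A B C : set R) : (0 < l)%R -> (0 < k)%R ->
  measurable A -> measurable B -> measurable C -> A !=set0 -> B !=set0 ->
  (forall x y, A x -> B y -> C (l * x + k * y)%R) ->
  l%:E * mu A + k%:E * mu B <= mu C.
Proof.
move=> l0 k0 mA mB mC [a Aa] [b Bb] ABC.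
have cpt (K K' : set R) : compact K -> K `<=` A -> compact K' -> K' `<=` B ->
    l%:E * mu K + k%:E * mu K' <= mu C.
  move=> cK KA cK' K'B.
  have cp (p : R) D : compact D -> compact (D `|` [set p]).
    by move=> cD; apply: compactU => //; exact: compact_set1.
  have le_mu (p : R) D : compact D -> mu D <= mu (D `|` [set p]).
    move=> cD; apply: le_measure; rewrite ?inE; last exact: subsetUl.
      exact: compact_measurable.
    exact: compact_measurable (cp p _ cD).
  apply: (@le_trans _ _ (l%:E * mu (K `|` [set a]) + k%:E * mu (K' `|` [set b]))).
    by apply: leeD; apply: lee_wpmul2l;
      [rewrite lee_fin ltW|exact: le_mu|rewrite lee_fin ltW|exact: le_mu].
  apply: brunn_minkowski1_compact => //; try exact: cp.
  - by exists a; right.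
  - by exists b; right.
  by move=> x y [Kx|->] [K'y|->]; apply: ABC => //;
    [exact: KA|exact: K'B|exact: KA|exact: K'B].
(* The two suprema are taken one after the other, which needs subtractions:
   they are harmless because all the measures below are finite. *)
have [->|Cfin] := eqVneq (mu C) +oo; first by rewrite leey.
have muC : mu C \is a fin_num by rewrite ge0_fin_numE// ltey.
have ge0 (c : R) D : (0 < c)%R -> 0 <= c%:E * mu D.
  by move=> c0; rewrite mule_ge0// lee_fin ltW.
have fin (c : R) D : (0 < c)%R -> c%:E * mu D <= mu C -> c%:E * mu D \is a fin_num.
  by move=> c0 /le_lt_trans h; rewrite ge0_fin_numE ?ge0// h// ltey.
have cptB K : compact K -> K `<=` A -> l%:E * mu K + k%:E * mu B <= mu C.
  move=> cK KA.
  have lK : l%:E * mu K \is a fin_num.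
    apply: fin => //.
    have := cpt K set0 cK KA compact0 (@sub0set _ _).
    by rewrite measure0 mule0 adde0.
  rewrite -leeBrDl// (lebesgue_regularity_inner_sup mB) -ereal_sup_pZl//.
  apply: ge_ereal_sup => _ [_ [K' [cK' K'B] <-] <-].
  by rewrite leeBrDl//; exact: cpt.
have kB : k%:E * mu B \is a fin_num.
  apply: fin => //; have := cptB set0 compact0 (@sub0set _ _).
  by rewrite measure0 mule0 add0e.
rewrite -leeBrDr// (lebesgue_regularity_inner_sup mA) -ereal_sup_pZl//.
apply: ge_ereal_sup => _ [_ [K [cK KA] <-] <-].
by rewrite leeBrDr//; exact: cptB.
Qed.
End brunn_minkowski.

(** * Level sets and truncation *)

Section layer_cake.
Context {d} {T : measurableType d} {R : realType}.
Local Notation mu := (@lebesgue_measure R).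
Local Open Scope ereal_scope.

(** The part of the subgraph of [f] of heights between 0 and 1, whose measure is
    computed by slicing in either direction. *)
Let strip (f : T -> \bar R) : set (T * measurableTypeR R) :=
  [set z | (0 < z.2 < 1)%R /\ z.2%:E < f z.1].

Let measurable_strip f : measurable_fun setT f -> measurable (strip f).
Proof.
move=> mf.
rewrite (_ : strip f = (setT `*` `]0%R, 1%R[%classic) `&`
    (setT `&` [set z : T * measurableTypeR R | z.2%:E < f z.1])); last first.
  apply/seteqP; split => -[x s]; rewrite /strip/= ?in_itv/=.
    by move=> [-> ->].
  by move=> [[_ ->] [_ ->]].
apply: measurableI; first exact: measurableX.
apply: measurable_fun_lte => //.
- by apply/measurable_EFinP; exact: measurable_snd.
- exact: (measurableT_comp mf measurable_fst).
Qed.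

Lemma measurable_fun_level (m : {sigma_finite_measure set T -> \bar R})
    (f : T -> \bar R) : measurable_fun setT f ->
  measurable_fun (`]0%R, 1%R[%classic : set (measurableTypeR R))
    (fun s => m [set x | s%:E < f x]).
Proof.
move=> mf.
have := measurable_fun_ysection m (measurable_strip mf).
move=> /(measurable_funTS (D := (`]0%R, 1%R[%classic : set (measurableTypeR R)))).
apply: eq_measurable_fun => s; rewrite inE/= in_itv/= => s01.
by congr (m _); apply/seteqP; split => x; rewrite /ysection/= inE/=; [case|].
Qed.

Lemma layer_cake1 (m : {sigma_finite_measure set T -> \bar R}) (f : T -> \bar R) :
  measurable_fun setT f -> (forall x, 0 <= f x) ->
  \int[mu]_(s in `]0%R, 1%R[) m [set x | s%:E < f x] = \int[m]_x mine (f x) 1.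
Proof.
move=> mf f0.
transitivity (\int[mu]_s (m \o ysection (strip f)) s).
  rewrite integral_mkcond; apply: eq_integral => s _ /=; rewrite patchE.
  case: ifPn => [|/negP]; rewrite inE/= in_itv/= => s01.
    by congr (m _); apply/seteqP; split => x; rewrite /ysection/= inE/=; [|case].
  rewrite (_ : ysection _ _ = set0) ?measure0//.
  by apply/seteqP; split => x //; rewrite /ysection/= inE/= => -[].
have := indic_fubini_tonelli m mu (measurable_strip mf).
rewrite indic_fubini_tonelli_FE; last exact: measurable_strip.
rewrite indic_fubini_tonelli_GE; last exact: measurable_strip.
move=> <-; apply: eq_integral => x _ /=.
(* In both cases below the section is the interval of heights below [b]. *)
have sec (b : R) : (forall s, (0 < s < 1)%R -> s%:E < f x <-> (s < b)%R) ->
    (0 <= b <= 1)%R -> mu (xsection (strip f) x) = b%:E.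
  move=> fb /andP[b0 b1].
  rewrite (_ : xsection _ _ = `]0%R, b[%classic); last first.
    apply/seteqP; split => s; rewrite /xsection/= inE/= in_itv/=.
      by move=> [/[dup] s01 /andP[-> _] /fb ->].
    move=> /andP[s0 sb]; have s01 : (0 < s < 1)%R by rewrite s0 (lt_le_trans sb).
    by split=> //; exact/fb.
  rewrite lebesgue_measure_itv/= lte_fin; case: ifPn => [_|].
    by rewrite oppr0 adde0.
  by rewrite -leNgt => b0'; congr EFin; apply/eqP; rewrite eq_le b0.
have [f1|f1] := leP (f x) 1.
  move: (f x) (f0 x) f1 sec => [r| |]// r0 r1 sec.
  by apply: sec => [s _|]; rewrite ?lte_fin// -!lee_fin r0.
apply: sec => [s /andP[_ s1]|]; last by rewrite ler01 lexx.
by split=> // _; rewrite (lt_trans _ f1)// lte_fin.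
Qed.

(** A function whose integral exceeds [expR a] can be divided by a constant
    [expR c] so that it takes values above every [s < 1], while cutting it off at
    height 1 still leaves an integral above [expR (a - c)]. For a bounded
    function [expR c] is the supremum and nothing is cut off; for an unbounded
    one any height is exceeded, and monotone convergence provides a cut-off
    that is high enough. This is what makes the nonempty level sets required by
    the Brunn-Minkowski inequality available at every height below 1. *)
Lemma normalization (m : {measure set T -> \bar R}) (f : T -> \bar R) (a : R) :
  measurable_fun setT f -> (forall x, 0 <= f x) -> (expR a)%:E < \int[m]_x f x ->
  exists2 c : R,
    (expR (a - c))%:E < \int[m]_x mine ((expR (- c))%:E * f x) 1 &
    forall s : R, (s < 1)%R -> exists x, s%:E < (expR (- c))%:E * f x.
Proof.
move=> mf f0 af.
have E (c : R) x : mine ((expR (- c))%:E * f x) 1 =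
    (expR (- c))%:E * mine (f x) (expR c)%:E.
  rewrite /Order.min.
  rewrite -[X in _ < X](_ : (expR (- c))%:E * (expR c)%:E = 1); last first.
    by rewrite -EFinM -expRD addNr expR0.
  rewrite lte_pmul2l// ?lte_fin ?expR_gt0//; case: ifPn => // _.
  by rewrite -EFinM -expRD addNr expR0.
have mmin (c : R) : measurable_fun setT (fun x => mine (f x) (expR c)%:E).
  exact: measurable_mine.
have trunc (c : R) : (expR a)%:E < \int[m]_x mine (f x) (expR c)%:E ->
    (expR (a - c))%:E < \int[m]_x mine ((expR (- c))%:E * f x) 1.
  move=> h; under eq_integral do rewrite E.
  rewrite ge0_integralZl_EFin// ?expR_ge0//; last first.
    by move=> x _; rewrite le_min f0 lee_fin expR_ge0.
  by rewrite addrC expRD EFinM lte_pmul2l// lte_fin expR_gt0.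
have sc (c s : R) x : (s%:E < (expR (- c))%:E * f x) = ((expR c * s)%:E < f x).
  by rewrite expRN lte_pdivlMl ?expR_gt0// EFinM.
have [bnd|nbnd] := pselect (exists M : R, forall x, f x <= M%:E).
  have [M fM] := bnd.
  pose S := ereal_sup (range f).
  have SM : S <= M%:E by apply: ge_ereal_sup => _ [x _ <-].
  have fS x : f x <= S by apply: ereal_sup_ubound; exists x.
  have S0 : 0 < S.
    rewrite ltNge; apply/negP => S0; move: af.
    rewrite integral0_eq ?ltNge ?lee_fin ?expR_ge0// => x _.
    by apply/eqP; rewrite eq_le f0 (le_trans (fS x)).
  have Sfin : S \is a fin_num.
    by rewrite ge0_fin_numE ?ltW// (le_lt_trans SM)// ltry.
  have s0 : (0 < fine S)%R by rewrite fine_gt0// S0 (le_lt_trans SM)// ltry.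
  exists (ln (fine S)).
    apply: trunc; rewrite lnK// fineK//.
    by under eq_integral do rewrite min_l//.
  move=> s s1.
  have : (fine S * s)%:E < S by rewrite -{2}(fineK Sfin) lte_fin gtr_pMr.
  by move=> /ereal_sup_gt[_ [x _ <-]] h; exists x; rewrite sc lnK.
have unb (r : R) : exists x, r%:E < f x.
  apply/not_existsP => h; apply: nbnd; exists r => x.
  by rewrite leNgt; apply/negP/h.
suff [n an] : exists n : nat, (expR a)%:E < \int[m]_x mine (f x) (expR n%:R)%:E.
  exists n%:R; first exact: trunc.
  by move=> s _; have [x] := unb (expR n%:R * s)%R; exists x; rewrite sc.
apply/not_existsP => h; move: af; apply/negP; rewrite -leNgt.
have nd x : nondecreasing_seq (fun n : nat => mine (f x) (expR n%:R)%:E).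
  move=> i j ij; rewrite le_min !ge_min lexx/= lee_fin ler_expR ler_nat ij.
  by rewrite orbT.
have lim x : limn (fun n : nat => mine (f x) (expR n%:R)%:E) = f x.
  apply/eqP; rewrite eq_le; apply/andP; split.
    apply: lime_le; first exact: ereal_nondecreasing_is_cvgn.
    by near=> n; rewrite ge_min lexx.
  rewrite leNgt; apply/negP.
  set L := limn _ => Lf.
  have LE n : mine (f x) (expR n%:R)%:E <= L.
    rewrite /L (cvg_lim _ (ereal_nondecreasing_cvgn (nd x)))//.
    by apply: ereal_sup_ubound; exists n.
  have [n Ln] : exists n : nat, L < (expR n%:R)%:E.
    have : L \is a fin_num.
      rewrite ge0_fin_numE; first by rewrite (lt_le_trans Lf)// leey.
      by apply: le_trans (LE 0%N); rewrite le_min f0 lee_fin expR_ge0.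
    move=> /fineK; set M := fine L => <-; exists (Num.bound `|M|); rewrite lte_fin.
    rewrite (le_lt_trans (ler_norm _))//.
    apply: lt_le_trans (archi_boundP _) _ => //.
    by apply: le_trans (expR_ge1Dx _); rewrite addrC lerDl.
  by have := LE n; rewrite leNgt lt_min Lf Ln.
under eq_integral do rewrite -lim.
rewrite monotone_convergence//; last first.
  by move=> n x _; rewrite le_min f0 lee_fin expR_ge0.
apply: lime_le.
  apply: ereal_nondecreasing_is_cvgn => i j ij; apply: ge0_le_integral => //.
  - by move=> x _; rewrite le_min f0 lee_fin expR_ge0.
  - by move=> x _; exact: nd.
by near=> n; rewrite leNgt; apply/negP/h.
Unshelve. all: by end_near. Qed.

End layer_cake.

(** * The Prekopa-Leindler inequality *)

Section prekopa_leindler.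
Context {R : realType}.
Variables (l k : R).
Hypotheses (l0 : 0 < l) (k0 : 0 < k) (lk1 : l + k = 1).
Local Notation mu := (@lebesgue_measure R).
Local Notation rT := (measurableTypeR R).
Local Open Scope ereal_scope.

(** The hypothesis [h (l x + k y) >= f x ^ l * g y ^ k] of the Prekopa-Leindler
    inequality, expressed with real thresholds below [f x] and [g y]: this avoids
    powers and products of infinite values, and makes sense without change for
    the integrals of [f], [g] and [h], hence for an induction on the dimension.
    The strict inequality on [h] is inherited by level sets and by integrals. *)
Definition log_dominates {E : Type} (mix : E -> E -> E) (f g h : E -> \bar R) :=
  forall x y a b, (expR a)%:E < f x -> (expR b)%:E < g y ->
    (expR (l * a + k * b))%:E < h (mix x y).

Lemma expR_conv a b : (expR (l * a + k * b) <= l * expR a + k * expR b)%R.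
Proof.
have l01 : (0 <= l <= 1)%R by rewrite ltW//= -lk1 lerDl ltW.
have -> : k = (1 - l)%R by rewrite -lk1 addrAC subrr add0r.
exact: (convex_expR (Itv01 (andP l01).1 (andP l01).2)).
Qed.

(** At each height [s] below 1 the level set of [h] contains the combination of
    the level sets of [f] and [g], because [s ^ l * s ^ k = s]. The
    Brunn-Minkowski inequality holds at each height, and integrating it over
    the heights gives the result by the layer-cake formula. *)
Lemma normalized_prekopa_leindler1 (f g h : rT -> \bar R) :
  measurable_fun setT f -> measurable_fun setT g -> measurable_fun setT h ->
  (forall x, 0 <= f x) -> (forall x, 0 <= g x) -> (forall x, 0 <= h x) ->
  (forall s : R, (s < 1)%R -> exists x, s%:E < f x) ->
  (forall s : R, (s < 1)%R -> exists x, s%:E < g x) ->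
  log_dominates (fun x y => l * x + k * y)%R f g h ->
  l%:E * (\int[mu]_x mine (f x) 1) + k%:E * (\int[mu]_x mine (g x) 1)
  <= \int[mu]_x h x.
Proof.
move=> mf mg mh f0 g0 h0 supf supg dom.
have mlev (u : rT -> \bar R) (s : R) : measurable_fun setT u ->
    measurable [set x | s%:E < u x].
  move=> mu'; rewrite -[X in measurable X]setTI.
  exact: emeasurable_fun_o_infty.
apply: (@le_trans _ _ (\int[mu]_x mine (h x) 1)); last first.
  apply: ge0_le_integral => //.
  - by move=> x _; rewrite le_min h0 lee01.
  - exact: measurable_mine.
  - by move=> x _; rewrite ge_min lexx.
rewrite -!layer_cake1//.
have mf' := measurable_fun_level mu mf.
have mg' := measurable_fun_level mu mg.
have mh' := measurable_fun_level mu mh.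
rewrite -[X in X + _]ge0_integralZl_EFin//; last exact: ltW.
rewrite -[X in _ + X]ge0_integralZl_EFin//; last exact: ltW.
rewrite -ge0_integralD//; last 4 first.
- by move=> s _; rewrite mule_ge0// lee_fin ltW.
- exact: measurable_funeM.
- by move=> s _; rewrite mule_ge0// lee_fin ltW.
- exact: measurable_funeM.
apply: ge0_le_integral => //.
- by move=> s _; rewrite adde_ge0// mule_ge0// ?lee_fin ?ltW.
- by apply: emeasurable_funD; exact: measurable_funeM.
move=> s; rewrite /= in_itv/= => /andP[s0 s1].
apply: brunn_minkowski1 => //; try exact: mlev;
  try by [exact: supf|exact: supg].
move=> x y /= fx gy.
have := dom x y (ln s) (ln s); rewrite !lnK// => /(_ fx gy).
by rewrite -mulrDl lk1 mul1r lnK.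
Qed.

Lemma log_dominates_scale {E : Type} (mix : E -> E -> E) (f g h : E -> \bar R)
    (c e : R) :
  log_dominates mix f g h ->
  log_dominates mix (fun x => (expR (- c))%:E * f x)
    (fun x => (expR (- e))%:E * g x)
    (fun x => (expR (- (l * c + k * e)))%:E * h x).
Proof.
move=> dom x y a b.
rewrite !expRN !lte_pdivlMl ?expR_gt0// -!EFinM -!expRD => /dom /[apply].
by congr (_ < _); congr (expR _)%:E; ring.
Qed.

(** After normalization the functions satisfy the arithmetic inequality above;
    the convexity of the exponential, i.e. the inequality between the arithmetic
    and the geometric means, turns it into the geometric one, which is
    invariant under the scalings used to normalize. *)
Lemma prekopa_leindler1 (f g h : rT -> \bar R) (a b : R) :
  measurable_fun setT f -> measurable_fun setT g -> measurable_fun setT h ->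
  (forall x, 0 <= f x) -> (forall x, 0 <= g x) -> (forall x, 0 <= h x) ->
  log_dominates (fun x y => l * x + k * y)%R f g h ->
  (expR a)%:E < \int[mu]_x f x -> (expR b)%:E < \int[mu]_x g x ->
  (expR (l * a + k * b))%:E < \int[mu]_x h x.
Proof.
move=> mf mg mh f0 g0 h0 dom af bg.
have [c ac supf] := normalization mf f0 af.
have [e be supg] := normalization mg g0 bg.
have pos (z : R) (u : rT -> \bar R) : (forall x, 0 <= u x) ->
    forall x, 0 <= (expR z)%:E * u x.
  by move=> u0 x; rewrite mule_ge0// lee_fin expR_ge0.
have mZ (z : R) (u : rT -> \bar R) : measurable_fun setT u ->
    measurable_fun setT (fun x => (expR z)%:E * u x).
  exact: measurable_funeM.
have := normalized_prekopa_leindler1 (mZ _ _ mf) (mZ _ _ mg) (mZ _ _ mh)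
  (pos _ _ f0) (pos _ _ g0) (pos _ _ h0) supf supg (log_dominates_scale dom).
rewrite [X in _ <= X -> _]ge0_integralZl_EFin ?expR_ge0//.
move=> /(lt_le_trans _) lt.
rewrite -[(l * a + k * b)%R](subrK (l * c + k * e)%R) addrC expRD EFinM.
rewrite -lte_pdivlMl ?expR_gt0// -expRN.
apply: lt.
apply: (@le_lt_trans _ _ (l%:E * (expR (a - c))%:E + k%:E * (expR (b - e))%:E)).
  rewrite -!EFinM -EFinD lee_fin; apply: le_trans (expR_conv _ _).
  by rewrite ler_expR le_eqVlt; apply/orP; left; apply/eqP; ring.
by apply: lteD; rewrite lte_pmul2l// lte_fin.
Qed.

Definition tuple_mix n (x y : n.-tuple R) : n.-tuple R :=
  [tuple (l * tnth x i + k * tnth y i)%R | i < n].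

Lemma tuple_mix_cons n (x y : rT * n.-tuple rT) :
  tuple_mix (cons_pair x) (cons_pair y) =
  cons_pair ((l * x.1 + k * y.1)%R, tuple_mix x.2 y.2).
Proof.
apply: eq_from_tnth => i; rewrite tnth_mktuple.
case: (unliftP ord0 i) => [j ->|->]; last by [].
by rewrite /cons_pair !tnthS tnth_mktuple.
Qed.

Lemma integral_lebesgue_tupleS n (f : n.+1.-tuple rT -> \bar R) :
  measurable_fun setT f -> (forall x, 0 <= f x) ->
  \int[lebesgue_tuple n.+1]_t f t =
  \int[mu]_x \int[lebesgue_tuple n]_t f (cons_pair (x, t)).
Proof.
move=> mf f0.
rewrite -(fubini_tonelli1 (m1 := mu) (m2 := lebesgue_tuple n)
  (fun z => f (cons_pair z)))//; last first.
  exact: measurableT_comp mf (@measurable_cons_pair R n).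
transitivity (\int[pushforward (mu \x lebesgue_tuple n) (@cons_pair R n)]_t f t).
  by [].
by rewrite ge0_integral_pushforward//; exact: measurable_cons_pair.
Qed.

(** For fixed first coordinates the sections of [f], [g] and [h] satisfy the
    hypothesis in dimension [n]; the induction hypothesis says that the
    integrals of these sections, as functions of the first coordinate, satisfy
    the hypothesis in dimension 1. *)
Lemma prekopa_leindler n (f g h : n.-tuple rT -> \bar R) (a b : R) :
  measurable_fun setT f -> measurable_fun setT g -> measurable_fun setT h ->
  (forall x, 0 <= f x) -> (forall x, 0 <= g x) -> (forall x, 0 <= h x) ->
  log_dominates (@tuple_mix n) f g h ->
  (expR a)%:E < \int[lebesgue_tuple n]_t f t ->
  (expR b)%:E < \int[lebesgue_tuple n]_t g t ->
  (expR (l * a + k * b))%:E < \int[lebesgue_tuple n]_t h t.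
Proof.
elim: n => [|n IH] in f g h a b *.
  move=> mf mg mh f0 g0 h0 dom.
  rewrite !integral_dirac//= !diracT !mul1e => fa gb.
  by have := dom _ _ _ _ fa gb; rewrite [tuple_mix _ _]tuple0.
move=> mf mg mh f0 g0 h0 dom.
rewrite !integral_lebesgue_tupleS//.
have msec (u : n.+1.-tuple rT -> \bar R) x : measurable_fun setT u ->
    measurable_fun setT (fun t : n.-tuple rT => u (cons_pair (x, t))).
  move=> mu'; apply: (measurableT_comp mu').
  by apply: (measurableT_comp (@measurable_cons_pair R n)); exact: pair1_measurable.
have mint (u : n.+1.-tuple rT -> \bar R) :
    measurable_fun setT u -> (forall x, 0 <= u x) ->
    measurable_fun setT
      (fun x : rT => \int[lebesgue_tuple n]_t u (cons_pair (x, t))).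
  move=> mu' u0.
  apply: (measurable_fun_fubini_tonelli_F (m2 := lebesgue_tuple n)
    (fun z => u (cons_pair z))) => //.
  exact: measurableT_comp mu' (@measurable_cons_pair R n).
apply: prekopa_leindler1; try exact: mint; try by move=> x; exact: integral_ge0.
move=> x y a' b'; apply: IH; try exact: msec; try by [].
move=> s t a'' b'' fa gb.
by have := dom _ _ _ _ fa gb; rewrite tuple_mix_cons.
Qed.

End prekopa_leindler.

(** * Log-concavity of the distribution functions *)

Lemma mulmx_conv (R : comPzRingType) n d (M : 'M[R]_(n, d)) (l k : R)
    (x y : 'cV[R]_d) i :
  (M *m (l *: x + k *: y)) i 0 = l * (M *m x) i 0 + k * (M *m y) i 0.
Proof.
by rewrite mulmxDr -!scalemxAr [LHS]mxE; congr (_ + _); rewrite [LHS]mxE.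
Qed.

Lemma measurable_half_space {disp : measure_display}
    {T : measurableType disp} {R : realType} d (V : T -> 'cV[R]_d)
    (c : 'rV[R]_d) (s : R) :
  (forall i, measurable_fun setT (Defs.coord V i)) ->
  measurable [set omega | (c *m V omega) 0 0 <= s].
Proof.
move=> mV; rewrite -[X in measurable X]setTI.
apply: (_ : measurable_fun setT (fun omega => (c *m V omega) 0 0 <= s)) => //;
  last first.
apply: measurable_fun_ler => //.
under eq_fun do rewrite mxE; apply: measurable_sum => i.
by apply: measurable_funM => //; exact: mV.
Qed.

Section log_concavity.
Context {R : realType}.
Local Open Scope ereal_scope.

Lemma le_lne_expR (r : R) (y : \bar R) : (r%:E <= lne y) = ((expR r)%:E <= y).
Proof.
move: y => [y| |] /=; rewrite ?leey//.
have [y0|y0] := leP y 0%R.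
  by rewrite leNgt ltNyr lee_fin leNgt (le_lt_trans y0)// expR_gt0.
by rewrite !lee_fin -ler_expR lnK.
Qed.

Lemma le_EFin_sub (t r : R) (y : \bar R) :
  (t%:E - y <= r%:E) = ((t - r)%:E <= y).
Proof.
move: y => [y| |] /=; rewrite ?leey ?leNye//.
by rewrite -EFinB !lee_fin; lra.
Qed.

(** The convexity of the epigraph is used at the points of height
    [- ln (psi _)], where the density is positive. *)
Lemma log_concave_dominates (E : lmodType R) (psi : E -> R) (l k : R) :
  (0 < l)%R -> (0 < k)%R -> (l + k = 1)%R -> log_concave psi ->
  log_dominates l k (fun x y : E => l *: x + k *: y)%R
    (EFin \o psi) (EFin \o psi) (EFin \o psi).
Proof.
move=> l0 k0 lk1 [psi0 cpsi] x y a b /=; rewrite !lte_fin => ax bY.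
have x0 : (0 < psi x)%R := lt_trans (expR_gt0 a) ax.
have y0 : (0 < psi y)%R := lt_trans (expR_gt0 b) bY.
have l01 : (0 <= l <= 1)%R by rewrite ltW//= -lk1 lerDl ltW.
pose p := Itv01 (andP l01).1 (andP l01).2.
have epi (z : E) : (0 < psi z)%R -> - lne (psi z)%:E <= (- ln (psi z))%:E.
  by move=> z0; rewrite lne_EFin.
have pk : (1 - p%:num)%R = k by rewrite /= -lk1 addrAC subrr add0r.
have : - lne (psi (l *: x + k *: y)%R)%:E
    <= (l * - ln (psi x) + k * - ln (psi y))%:E.
  rewrite -pk; exact: set_mem (cpsi (x, - ln (psi x))%R (y, - ln (psi y))%R p
    (mem_set (epi x x0)) (mem_set (epi y y0))).
rewrite !mulrN -opprD leeNl -EFinN opprK le_lne_expR lee_fin.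
by apply: lt_le_trans; rewrite ltr_expR ltrD// ltr_pM2l// -ltr_expR lnK.
Qed.

(** A point of the epigraph gives a lower bound for [lne (Phi _)]; lowering it by
    an arbitrary [e > 0] makes it strict, as [log_dominates] requires. *)
Lemma log_dominates_econvex (E : lmodType R) (Phi : R -> \bar R) (t s : E -> R) :
  (forall l k, (0 < l)%R -> (0 < k)%R -> (l + k = 1)%R ->
     log_dominates l k (fun x y => l * x + k * y)%R Phi Phi Phi) ->
  (forall l k, (l + k = 1)%R ->
     {morph t : x y / l *: x + k *: y >-> l * x + k * y})%R ->
  (forall l k, (l + k = 1)%R ->
     {morph s : x y / l *: x + k *: y >-> l * x + k * y})%R ->
  econvex_function (fun z => (t z)%:E - lne (Phi (s z))).
Proof.
move=> dom tE sE; apply/convex_setW => x y; rewrite !inE => xr yr p p0 p1.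
have k0 : (0 < 1 - p%:num)%R by rewrite subr_gt0.
have lk1 : (p%:num + (1 - p%:num) = 1)%R by rewrite subrKC.
suff : (t (p%:num *: x.1 + (1 - p%:num) *: y.1))%R%:E
      - lne (Phi (s (p%:num *: x.1 + (1 - p%:num) *: y.1))%R)
    <= (p%:num * x.2 + (1 - p%:num) * y.2)%R%:E by exact: mem_set.
move: xr yr; rewrite /=.
rewrite (tE _ _ lk1) (sE _ _ lk1) !le_EFin_sub => xr yr.
apply/lee_subgt0Pr => e e0.
rewrite -EFinB le_lne_expR.
have sub z r : (r%:E <= lne (Phi z)) -> (expR (r - e))%:E < Phi z.
  rewrite le_lne_expR; apply: lt_le_trans; rewrite lte_fin ltr_expR; lra.
have := dom _ _ p0 k0 lk1 _ _ _ _ (sub _ _ xr) (sub _ _ yr).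
move=> /ltW; congr (_ <= _); congr (expR _)%:E.
by ring.
Qed.

Section half_space.
Context {disp : measure_display} {T : measurableType disp}.
Variables (P : probability T R) (d : nat) (V : T -> 'cV[R]_d).
Variable psi : 'cV[R]_d -> R.
Hypotheses (V_psi : has_density P V psi) (psi_lc : log_concave psi).

(** The probability of the half-space of level [s] is the integral of [psi] cut
    off outside it. A combination of points of the half-spaces of levels [s] and
    [s'] lies in the half-space whose level is the same combination of [s] and
    [s'], so the three truncated densities satisfy the hypothesis of the
    Prekopa-Leindler inequality. *)
Lemma cdf_linear_log_dominates (c : 'rV[R]_d) (l k : R) :
  (0 < l)%R -> (0 < k)%R -> (l + k = 1)%R ->
  let Phi s := P [set w | (c *m V w) 0 0 <= s]%R in
  log_dominates l k (fun x y => l * x + k * y)%R Phi Phi Phi.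
Proof.
move=> l0 k0 lk1 Phi s s' a b.
have [psi0 mpsi VE] := V_psi.
pose vec (t : d.-tuple (measurableTypeR R)) : 'cV[R]_d := \col_i tnth t i.
pose S s : set (d.-tuple (measurableTypeR R)) := [set t | (c *m vec t) 0 0 <= s]%R.
have mS r : measurable (S r).
  apply: measurable_half_space => i.
  rewrite (_ : Defs.coord vec i = (@tnth _ _ ^~ i)); first exact: measurable_tnth.
  by apply/funext => t; rewrite /Defs.coord mxE.
have PhiE r : Phi r =
    \int[lebesgue_tuple d]_t (((fun t => (psi (vec t))%:E) \_ (S r)) t).
  rewrite -integral_mkcond -VE//; congr (P _); apply/seteqP.
  have vV w : vec [tuple (V w i 0)%R | i < d] = V w.
    by apply/matrixP => i j; rewrite mxE tnth_mktuple ord1.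
  by split => w; rewrite /S /= vV.
have mf r : measurable_fun setT ((fun t => (psi (vec t))%:E) \_ (S r)).
  apply/(measurable_restrictT _ (mS r)); apply: measurable_funTS.
  exact/measurable_EFinP.
have f0 r t : 0 <= ((fun t => (psi (vec t))%:E) \_ (S r)) t.
  by rewrite patchE; case: ifPn => // _; rewrite lee_fin.
rewrite !PhiE; apply: prekopa_leindler => //.
move=> x y a' b'; rewrite !patchE.
case: ifPn => [|_]; last by rewrite lte_fin ltNge expR_ge0.
rewrite inE => Sx px.
case: ifPn => [|_]; last by rewrite lte_fin ltNge expR_ge0.
rewrite inE => Sy py.
have vmix : vec (tuple_mix l k x y) = (l *: vec x + k *: vec y)%R.
  by apply/matrixP => i j; rewrite !mxE tnth_mktuple.
rewrite ifT; last first.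
  by rewrite inE /S /= vmix mulmx_conv lerD// ler_wpM2l// ltW.
by rewrite vmix; apply: log_concave_dominates px py.
Qed.

End half_space.
End log_concavity.

(** * Solution of the dynamics *)

Section trajectory.
Context {R : realType} {n m N : nat}.
Variables (A : 'I_N -> 'M[R]_n) (B : 'I_N -> 'M[R]_(n, m)) (x0 : 'cV[R]_n).

Lemma ext_ord {V : zmodType} (f : 'I_N -> V) (i : 'I_N) : ext f i = f i.
Proof. by rewrite /ext valK. Qed.

Lemma stateE (u : 'I_N -> 'cV[R]_m) (w : 'I_N -> 'cV[R]_n) k : (k <= N)%N ->
  state A B x0 u w k = transition A 0 k *m x0
    + \sum_(j < N | (j < k)%N) transition A j.+1 k *m (B j *m u j + w j).
Proof.
elim: k => [_|k IH kN]; first by rewrite mul1mx big_pred0// addr0.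
pose i := Ordinal kN.
have extk (V : zmodType) (f : 'I_N -> V) : ext f k = f i by exact: ext_ord f i.
rewrite /= !extk IH; last exact: ltnW.
rewrite mulmxDr mulmxA -!addrA; congr (_ + _).
rewrite [in RHS](bigD1 i)//= ltnn mul1mx [RHS]addrC; congr (_ + _).
rewrite mulmx_sumr; apply: eq_big => [j|j /= jk].
  by rewrite ltnS ltn_neqAle andbC.
by rewrite jk mulmxA.
Qed.

Lemma trajectoryE (U : 'cV[R]_(stacked N m)) (w : 'I_N -> 'cV[R]_n) :
  trajectory A B x0 U w =
  Abar A *m x0 + Hmx A B *m U + Gmx A *m \mxcol_(k < N) w k.
Proof.
rewrite -{2}[U]submxcolK /Hmx /Gmx !mul_mxblock_mxrow.
have -> : Abar A *m x0 = \mxcol_(k < N) (transition A 0 k.+1 *m x0).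
  by apply/mxcolP => i; rewrite -submxcol_mul !mxcolK.
rewrite -!mxcolD; apply: eq_mxcol => i.
rewrite stateE// -addrA -big_split/= [in LHS]big_mkcond/=; congr (_ + _).
apply: eq_bigr => j _; rewrite ltnS.
by case: ifP => _; rewrite ?mul0mx ?addr0// mulmxDr mulmxA.
Qed.

End trajectory.

(** * Probabilistic estimates *)

Section boole.
Context {d} {T : measurableType d} {R : realType}.
Variable P : probability T R.
Local Open Scope ereal_scope.

Lemma bonferroni n (E : 'I_n -> set T) (p : 'I_n -> R) :
  (forall i, measurable (E i)) -> (forall i, (p i)%:E <= P (E i)) ->
  (1 - \sum_(i < n) (1 - p i))%R%:E <= P (\bigcap_i E i).
Proof.
move=> mE pE.
have mcap : measurable (\bigcap_i E i).
  by apply: fin_bigcap_measurable => //; exact: finite_finset.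
pose F k := if insub k is Some i then ~` E i else set0.
have FE (i : 'I_n) : F i = ~` E i by rewrite /F valK.
have : P (~` \bigcap_i E i) <= (\sum_(i < n) (1 - p i))%R%:E.
  apply: (@le_trans _ _ (\sum_(i < n) P (F i))).
    apply: content_subadditive.
    - by move=> k _; rewrite /F; case: insub => [i|//]; exact: measurableC.
    - exact: measurableC.
    - rewrite setC_bigcap => w [i _ Ei]; rewrite -bigcup_mkord.
      by exists i => //=; rewrite FE.
  rewrite -sumEFin; apply: lee_sum => i _; rewrite FE probability_setC//.
  by rewrite EFinB leeB.
rewrite probability_setC// => h.
rewrite EFinB leeBlDr// addeC -leeBlDr//.
by rewrite fin_num_measure.
Qed.
End boole.

Section mean_covariance.
Context {disp : measure_display} {T : measurableType disp} {R : realType}.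
Variable P : probability T R.

Lemma affine_integrable d e (W : T -> 'cV[R]_d) (M : 'M[R]_(e, d)) (b : 'cV[R]_e) :
  (forall i, Defs.coord W i \in Lfun P 1) ->
  forall i, Defs.coord (fun w => b + M *m W w) i \in Lfun P 1.
Proof.
move=> W1 i.
rewrite (_ : Defs.coord _ i = cst (b i 0) \+ \sum_j (M i j \o* Defs.coord W j)).
  apply: rpredD; first exact: Lfun_cst.
  by apply: rpred_sum => j _; apply: Lfun_scale.
apply/funext => w; rewrite /Defs.coord !mxE/= fct_sumE; congr (_ + _).
by apply: eq_bigr => j _ /=; rewrite mulrC.
Qed.

Lemma expectation_shift (X : T -> R) (c : R) : X \in Lfun P 1 ->
  fine 'E_P[(fun w => X w + c)%R] = fine 'E_P[X] + c.
Proof.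
move=> X1; rewrite (_ : (fun w => _) = X \+ cst c)//.
rewrite expectationD// ?Lfun_cst// expectation_cst fineD//.
exact: expectation_fin_num.
Qed.

Lemma mean_vec_shift d (V : T -> 'cV[R]_d) (c : 'cV[R]_d) :
  (forall i, Defs.coord V i \in Lfun P 1) ->
  mean_vec P (fun w => V w + c) = mean_vec P V + c.
Proof.
move=> V1; apply/matrixP => i j; rewrite ord1 !mxE -expectation_shift//.
by congr (fine (expectation P _)); apply/funext => w; rewrite /Defs.coord mxE.
Qed.

Lemma cov_mx_shift d (V : T -> 'cV[R]_d) (c : 'cV[R]_d) :
  (forall i, Defs.coord V i \in Lfun P 1) ->
  cov_mx P (fun w => V w + c) = cov_mx P V.
Proof.
move=> V1; apply/matrixP => i j; rewrite !mxE.
have E k : Defs.coord (fun w => V w + c) k = (fun w => Defs.coord V k w + c k 0).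
  by apply/funext => w; rewrite /Defs.coord mxE.
rewrite unlock !E !expectation_shift//; congr (fine (expectation P _)).
apply/funext => w; rewrite /= !fctE/=. by congr (_ * _); ring.
Qed.

End mean_covariance.

(** * Convexity of the cost and of the constraints *)

Section convex_costs.
Context {R : realType}.

Lemma quad_comb d (M : 'M[R]_d) (a b : R) (x y : 'cV[R]_d) :
  quad M (a *: x + b *: y) = a ^+ 2 * quad M x
    + a * b * ((x^T *m M *m y) 0 0 + (y^T *m M *m x) 0 0) + b ^+ 2 * quad M y.
Proof.
have T : (a *: x + b *: y)^T = a *: x^T + b *: y^T.
  by apply/matrixP => i j; rewrite !mxE.
rewrite /quad T !mulmxDl !mulmxDr -!scalemxAl -!scalemxAr.
have E (X Y : 'M[R]_1) : (X + Y) 0 0 = X 0 0 + Y 0 0 by rewrite mxE.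
have Z c (X : 'M[R]_1) : (c *: X) 0 0 = c * X 0 0 by rewrite mxE.
rewrite !E !Z; ring.
Qed.

(** The difference of the two sides is [p * (1 - p) * quad M (x - y)]. *)
Lemma quad_convex d (M : 'M[R]_d) (p : R) (x y : 'cV[R]_d) :
  (forall v, 0 <= quad M v) -> 0 <= p <= 1 ->
  quad M (p *: x + (1 - p) *: y) <= p * quad M x + (1 - p) * quad M y.
Proof.
move=> M0 /andP[p0 p1].
have pq : 0 <= p * (1 - p) by rewrite mulr_ge0// subr_ge0.
have := mulr_ge0 pq (M0 (1 *: x + (-1) *: y)).
rewrite !quad_comb -subr_ge0 => h; rewrite -subr_ge0.
apply: le_trans h _; rewrite le_eqVlt; apply/orP; left; apply/eqP; ring.
Qed.

(** Dividing [x] and [y] by their sums of exponentials reduces the claim to the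
    convexity of the exponential in each coordinate: the normalized exponentials
    of [x] sum to 1, and so do those of [y]. *)
Lemma log_sum_exp_convex n (c : R) : (0 < n)%N ->
  convex_function setT
    (fun t : 'cV[R]_n => ln (\sum_(i < n) expR (t i 0)) - c).
Proof.
move=> n0 p x y _ _.
have S0 (t : 'cV[R]_n) : 0 < \sum_(i < n) expR (t i 0).
  rewrite (bigD1 (Ordinal n0))//=; apply: ltr_pwDl; first exact: expR_gt0.
  by apply: sumr_ge0 => i _; exact: expR_ge0.
set S := fun t : 'cV[R]_n => \sum_(i < n) expR (t i 0).
suff : ln (S (p%:num *: x + (1 - p%:num) *: y))
    <= p%:num * ln (S x) + (1 - p%:num) * ln (S y).
  move=> h; change (ln (S (p%:num *: x + (1 - p%:num) *: y)) - c
    <= p%:num * (ln (S x) - c) + (1 - p%:num) * (ln (S y) - c)).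
  rewrite [leRHS](_ : _ =
    p%:num * ln (S x) + (1 - p%:num) * ln (S y) - c); last by ring.
  by rewrite lerD2r.
rewrite -[leRHS]expRK ler_ln ?posrE ?expR_gt0 ?S0//.
rewrite -[leRHS]mulr1 -ler_pdivrMl ?expR_gt0// -expRN mulr_sumr.
have E1 : 1 = p%:num * (\sum_i expR (x i 0 - ln (S x)))
    + (1 - p%:num) * (\sum_i expR (y i 0 - ln (S y))) :> R.
  have norm (t : 'cV[R]_n) : \sum_(i < n) expR (t i 0 - ln (S t)) = 1.
    under eq_bigr do rewrite expRD expRN lnK ?posrE ?S0//.
    by rewrite -mulr_suml divff// gt_eqF// S0.
  by rewrite !norm !mulr1 subrKC.
rewrite [leRHS]E1 !mulr_sumr -big_split/=; apply: ler_sum => i _.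
have conv (a b : R) : expR (p%:num * a + (1 - p%:num) * b)
    <= p%:num * expR a + (1 - p%:num) * expR b := convex_expR p a b.
apply: le_trans (conv _ _); rewrite -expRD ler_expR !mxE.
by rewrite le_eqVlt; apply/orP; left; apply/eqP; ring.
Qed.

End convex_costs.

Section constraints.
Context {R : realType}.

(** When [c] is infinite, the epigraph is empty or the whole space. *)
Lemma affine_econvex (E : lmodType R) (a : E -> R) (c : \bar R) (m : R) :
  (forall l k, l + k = 1 -> {morph a : x y / l *: x + k *: y >-> l * x + k * y}) ->
  econvex_function (fun z => (a z)%:E + c - m%:E)%E.
Proof.
move=> aE; case: c => [c| |]; apply/convex_setW => x y; rewrite !inE/=.
- move=> xr yr p p0 p1.
  suff : a (p%:num *: x.1 + (1 - p%:num) *: y.1) + c - m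
    <= p%:num * x.2 + (1 - p%:num) * y.2 by move=> h; exact: mem_set.
  rewrite aE ?subrKC// -subr_ge0.
  rewrite (_ : _ - _ = p%:num * (x.2 - (a x.1 + c - m))
    + (1 - p%:num) * (y.2 - (a y.1 + c - m))); last by ring.
  by apply: addr_ge0; apply: mulr_ge0; rewrite ?subr_ge0 -?lee_fin// -?EFinD ltW.
- by rewrite /= leye_eq.
- by move=> _ _ p _ _; apply: mem_set; rewrite /= leNye.
Qed.

Lemma polyhedron_convex r d (F : 'M[R]_(r, d)) (g : 'cV[R]_r) (p : R) x y :
  0 <= p <= 1 -> polyhedron F g x -> polyhedron F g y ->
  polyhedron F g (p *: x + (1 - p) *: y).
Proof.
move=> /andP[p0 p1] Fx Fy i; rewrite mulmx_conv.
rewrite [leRHS](_ : _ = p * g i 0 + (1 - p) * g i 0); last by ring.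
by apply: lerD; apply: ler_wpM2l; [|exact: Fx|rewrite subr_ge0|exact: Fy].
Qed.

Lemma input_power_convex m N (Uset : set 'cV[R]_m) (p : R) x y :
  polytope Uset -> 0 <= p <= 1 ->
  input_power (N := N) Uset x -> input_power Uset y ->
  input_power (N := N) Uset (p *: x + (1 - p) *: y).
Proof.
move=> [r [F [g ->]]] p01 Ux Uy k.
rewrite (_ : submxcol _ k = p *: submxcol x k + (1 - p) *: submxcol y k).
  exact: polyhedron_convex.
by apply/matrixP => i j; rewrite !mxE.
Qed.

End constraints.

(** * The control problems *)

Section control.
Context {disp : measure_display} {T : measurableType disp} {R : realType}.
Variable P : probability T R.
Context {n m N L : nat}.
Variables (A : 'I_N -> 'M[R]_n) (B : 'I_N -> 'M[R]_(n, m)) (x0 : 'cV[R]_n).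
Variable w : 'I_N -> T -> 'cV[R]_n.
Hypothesis W_L2 : square_integrable P (W w).

Lemma coord_W_integrable i : Defs.coord (W w) i \in Lfun P 1.
Proof. by apply: Lfun_subset12 => //; exact: fin_num_measure. Qed.

Lemma XrvE U : Xrv A B x0 w U =
  fun omega => (Abar A *m x0 + Gmx A *m W w omega) + Hmx A B *m U.
Proof. by apply/funext => o; rewrite /Xrv trajectoryE addrAC. Qed.

(** The input translates the trajectory by [Hmx *m U]: it shifts the mean and
    does not change the covariance, so that the trace term of the cost is a
    constant. *)
Lemma RA_costE Q Rm Xd : exists v c, forall U (t : 'cV[R]_L),
  RA_cost P A B x0 w Q Rm Xd U t
  = quad Q (v + Hmx A B *m U) + quad Rm U + c :> R.
Proof.
pose Y omega := Abar A *m x0 + Gmx A *m W w omega.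
have Y1 : forall i, Defs.coord Y i \in Lfun P 1.
  by apply: affine_integrable; exact: coord_W_integrable.
exists (mean_vec P Y - Xd), (\tr (Q *m cov_mx P Y)) => U t.
rewrite /RA_cost XrvE mean_vec_shift// cov_mx_shift//.
by rewrite [_ + _ - Xd]addrAC.
Qed.

Variables (Pm : 'M[R]_(L, stacked N n)) (q : 'cV[R]_L).

Lemma safe_rowE U omega i : ((Pm *m Xrv A B x0 w U omega) i 0 <= q i 0) =
  ((row i Pm *m Gmx A *m W w omega) 0 0 <= margin A x0 Pm q i - pHU A B Pm i U).
Proof.
rewrite XrvE /margin /pHU -!mulmxA -!row_mul.
have rowE (X : 'cV[R]_L) : (row i X) 0 0 = X i 0 by rewrite mxE.
have E (X Y : 'cV[R]_L) : (X + Y) i 0 = X i 0 + Y i 0 by rewrite mxE.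
by rewrite !rowE !mulmxDr !E; apply/idP/idP; lra.
Qed.

(** Boole's inequality: [expR (t i 0)] bounds from below the probability that the
    [i]-th inequality of the safe set holds, and constraint (f) says that the
    total allocated risk [\sum_i (1 - expR (t i 0))] is at most [Delta]. *)
Lemma RA_feasible_SOC Uset (Delta eps : R) U t : (1 <= L)%N -> Delta < 1 ->
  RA_feasible P A B x0 w Uset Pm q Delta eps U t ->
  SOC_feasible P A B x0 w Uset Pm q Delta U.
Proof.
move=> L1 D1 [Ub _ Ud _ Uf]; split => //.
pose E i := [set omega | (row i Pm *m Gmx A *m W w omega) 0 0
   <= margin A x0 Pm q i - pHU A B Pm i U].
have -> : [set omega | polyhedron Pm q (Xrv A B x0 w U omega)] = \bigcap_i E i.
  apply/seteqP; split => omega; first by move=> h i _; rewrite /E /= -safe_rowE.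
  by move=> h i; rewrite safe_rowE; exact: h.
have mE i : measurable (E i).
  apply: measurable_half_space => j.
  by have := coord_W_integrable j; rewrite inE => /andP[/[!inE]].
have pE i : ((expR (t i 0))%:E <= P (E i))%E by rewrite -le_lne_expR; exact: Ud.
apply: le_trans (bonferroni mE pE); rewrite lee_fin.
have L1R : 1 <= L%:R :> R by rewrite ler1n.
move: Uf; rewrite /RA_f ler_ln ?posrE; last 2 first.
- lra.
- rewrite (bigD1 (Ordinal L1))//=; apply: ltr_pwDl; first exact: expR_gt0.
  by apply: sumr_ge0 => i _; exact: expR_ge0.
rewrite sumrB sumr_const card_ord; lra.
Qed.

End control.

Theorem theorem1 (R : realType) (disp : measure_display)
    (T : measurableType disp) (P : probability T R)
    (n m N L : nat) (L_ge1 : (1 <= L)%N)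
    (A : 'I_N -> 'M[R]_n) (B : 'I_N -> 'M[R]_(n, m)) (x0 : 'cV[R]_n)
    (Uset : set 'cV[R]_m) (Uset_polytope : polytope Uset)
    (w : 'I_N -> T -> 'cV[R]_n)
    (W_L2 : square_integrable P (W w))
    (psi : 'cV[R]_(stacked N n) -> R) (W_density : has_density P (W w) psi)
    (psi_log_concave : log_concave psi)
    (Q : 'M[R]_(stacked N n)) (Q_psd : psd Q)
    (Rm : 'M[R]_(stacked N m)) (Rm_psd : psd Rm)
    (Pm : 'M[R]_(L, stacked N n)) (q : 'cV[R]_L)
    (Xd : 'cV[R]_(stacked N n)) (Xd_safe : polyhedron Pm q Xd)
    (Delta : R) (Delta_itv : 0 <= Delta < 1) (eps : R) (eps_gt0 : 0 < eps) :
  (forall U t, RA_feasible P A B x0 w Uset Pm q Delta eps U t ->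
     SOC_feasible P A B x0 w Uset Pm q Delta U)
  /\
  [/\ convex_function setT
        (fun z : 'cV[R]_(stacked N m) * 'cV[R]_L =>
           RA_cost P A B x0 w Q Rm Xd z.1 z.2),
      convex_set
        [set z : convex_lmodType ('cV[R]_(stacked N m) * 'cV[R]_L)%type |
           RA_b Uset z.1 z.2],
      forall i : 'I_L, convex_constraint
        [set z : 'cV[R]_(stacked N m) * 'cV[R]_L |
           RA_c P A B x0 w Pm q eps i z.1 z.2]
        (fun z => ((pHU A B Pm i z.1)%:E + Phi_inv P A w Pm i eps
                   - (margin A x0 Pm q i)%:E)%E),
      forall i : 'I_L, convex_constraint
        [set z : 'cV[R]_(stacked N m) * 'cV[R]_L |
           RA_d P A B x0 w Pm q i z.1 z.2]
        (fun z => ((z.2 i 0)%:E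
                   - lne (Phi P A w Pm i
                            (margin A x0 Pm q i - pHU A B Pm i z.1)))%E) &
      reverse_convex_constraint
        [set t : 'cV[R]_L | RA_f Delta t]
        (fun t => ln (\sum_(i < L) expR (t i 0)) - ln (L%:R - Delta))].
Proof.
have /andP[_ Delta_lt1] := Delta_itv.
split; first by move=> U t; exact: RA_feasible_SOC.
split.
- have [v [c costE]] := RA_costE (L := L) A B x0 W_L2 Q Rm Xd.
  move=> p x y _ _; have p01 : (0 : R) <= p%:num <= 1 by rewrite ge0 le1.
  rewrite !costE; set U := x.1; set V := y.1.
  change (quad Q (v + Hmx A B *m (p%:num *: U + (1 - p%:num) *: V))
      + quad Rm (p%:num *: U + (1 - p%:num) *: V) + c
    <= p%:num * (quad Q (v + Hmx A B *m U) + quad Rm U + c)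
      + (1 - p%:num) * (quad Q (v + Hmx A B *m V) + quad Rm V + c)).
  have -> : v + Hmx A B *m (p%:num *: U + (1 - p%:num) *: V)
      = p%:num *: (v + Hmx A B *m U) + (1 - p%:num) *: (v + Hmx A B *m V).
    rewrite mulmxDr -!scalemxAr !scalerDr addrACA -scalerDl subrKC.
    by rewrite scale1r.
  have := quad_convex (v + Hmx A B *m U) (v + Hmx A B *m V) Q_psd.2 p01.
  have := quad_convex U V Rm_psd.2 p01.
  lra.
- move=> x y p; rewrite !inE => xb yb.
  suff : input_power Uset (p%:num *: x.1 + (1 - p%:num) *: y.1) by [].
  by apply: input_power_convex => //; rewrite ge0 le1.
- move=> i; split.
    apply: affine_econvex => l k _ x y; exact: mulmx_conv.
  move=> z; rewrite /= /RA_c; case: (Phi_inv _ _ _ _ _ _) => [c| |].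
  + by rewrite -!EFinD !lee_fin; split; lra.
  + by rewrite /= !leye_eq.
  + by rewrite /= !leNye.
- move=> i; split; last first.
    by move=> z; rewrite /= /RA_d le_EFin_sub subr0.
  apply: log_dominates_econvex.
  + by move=> l k l0 k0 lk1; apply: (cdf_linear_log_dominates W_density).
  + by move=> l k _ x y /=; rewrite !mxE.
  + move=> l k lk1 x y /=.
    have -> : k = 1 - l by rewrite -lk1 addrAC subrr add0r.
    by rewrite /pHU mulmx_conv; ring.
- split; first exact: log_sum_exp_convex.
  by move=> t; rewrite /= /RA_f subr_ge0.
Qed.
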